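(* Let $A$ and $B$ be two monic Blaschke products of degree $n$. Suppose that there are $n$ points $\lambda_1,\dots,\lambda_n\in\mathbb{D}$ (not necessarily distinct) such that $A(\lambda_j)=B(\lambda_j)$ for $j=1,\dots,n$, counting multiplicities. Then $A=B$.
   Context: $\mathbb{D}$ is the open unit disk. A monic Blaschke product of degree $n$ is a function $\prod_{j=1}^n\frac{z-a_j}{1-\bar a_j z}$ with $a_1,\dots,a_n\in\mathbb{D}$ (not necessarily distinct). Two holomorphic functions $f$ and $g$ agree at $\lambda$ with multiplicity $k$ if $f-g$ has a zero of multiplicity $k$ at $\lambda$. ''Counting multiplicities'' means that if a value $\lambda$ occurs $k$ times in the list $\lambda_1,\dots,\lambda_n$, then $A-B$ vanishes at $\lambda$ to order at least $k$. *)

(* Defs.v *)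
From HB Require Import structures.
From mathcomp Require Import all_boot all_order all_algebra complex.
From mathcomp Require Import all_classical all_reals all_analysis.
Import Order.TTheory GRing.Theory Num.Theory.
Import numFieldNormedType.Exports.
Set Implicit Arguments.
Unset Strict Implicit.
Unset Printing Implicit Defensive.
Local Open Scope classical_set_scope.
Local Open Scope ring_scope.

(* The field R[i], typed as a numClosedFieldType so that the topological and
   normed structures attached to every numFieldType are inferred on it; in
   particular [derivable f z 1], for f : Cplx R -> Cplx R, is complex
   differentiability at z. *)
Definition Cplx (R : realType) : numClosedFieldType := R[i]%C.

Definition unit_disk (R : realType) : set (Cplx R) := [set z | `|z| < 1].

Definition blaschke (R : realType) (s : seq (Cplx R)) (z : Cplx R) : Cplx R :=
  \prod_(a <- s) ((z - a) / (1 - Num.conj a * z)).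

(* A Blaschke product is a function on the disk, so the values of f outside
   the disk are left unconstrained. *)
Definition monic_blaschke (R : realType) (n : nat) (f : Cplx R -> Cplx R) :=
  exists a : n.-tuple (Cplx R),
    (forall c, c \in a -> unit_disk c) /\
    (forall z, unit_disk z -> f z = blaschke a z).

(* f has a zero of multiplicity at least k at l: f(z) = (z - l)^k g(z) near l
   with g holomorphic near l.  The value g(l) may vanish, so f may also be
   identically zero near l. *)
Definition vanishes_to_order (R : realType) (f : Cplx R -> Cplx R) (k : nat)
    (l : Cplx R) :=
  exists g : Cplx R -> Cplx R,
    (\forall z \near l, derivable g z 1) /\
    (\forall z \near l, f z = (z - l) ^+ k * g z).

Definition agree_counting_multiplicities (R : realType)
    (f g : Cplx R -> Cplx R) (s : seq (Cplx R)) :=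
  forall l, l \in s ->
    vanishes_to_order (fun z => f z - g z) (count_mem l s) l.

(* Main.v *)
(* Write [A = Pa / Qa] and [B = Pb / Qb], where [Qa (z) = z^n conj (Pa (1 / conj z))],
   and let [L] be the monic polynomial with roots [lam], with reflection [Ql].
   The numerator [F = Pa Qb - Pb Qa] of [A - B] is divisible by [L] and is
   antisymmetric under reflection, so [F = c L Ql].  On the unit circle this reads
   [Qb / Qa - conj (Qb / Qa) = c |Ql / Qa|^2].  As [Qb / Qa] is holomorphic on the
   closed disk with value 1 at 0, the mean of the left side is 0, whence [c = 0]. *)

Require Import Defs.
From HB Require Import structures.
From mathcomp Require Import all_boot all_order all_algebra complex.
From mathcomp Require Import all_classical all_reals all_analysis.
From mathcomp Require Import cyclic separable cyclotomic.
From mathcomp Require Import ring.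
Import Order.TTheory GRing.Theory Num.Theory.
Import numFieldNormedType.Exports.
Set Implicit Arguments.
Unset Strict Implicit.
Unset Printing Implicit Defensive.
Local Open Scope classical_set_scope.
Local Open Scope ring_scope.

(** * Roots of unity as sample points on the unit circle *)

Lemma closed_prim_root_exists (F : closedFieldType) (n : nat) :
  (n%:R : F) != 0 -> exists w : F, n.-primitive_root w.
Proof.
move=> n0; have n_gt0 : (0 < n)%N by case: n n0 => //; rewrite eqxx.
pose p : {poly F} := 'X^n - 1; have [r Dp] := closed_field_poly_normal p.
rewrite (monicP _) ?monicXnsubC // scale1r in Dp.
have rn1: all n.-unity_root r by apply/allP=> z; rewrite -root_prod_XsubC -Dp.
have sz_r: (n < (size r).+1)%N.
  by rewrite -(size_prod_XsubC r id) -Dp size_XnsubC.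
have [|z] := hasP (has_prim_root n_gt0 rn1 _ sz_r); last by exists z.
(* Since [n] is nonzero in [F], [X^n - 1] is separable and its roots are distinct. *)
by rewrite -separable_prod_XsubC -Dp separable_Xn_sub_1.
Qed.

Lemma norm_prim_root (C : numClosedFieldType) (n : nat) (w : C) :
  n.-primitive_root w -> `|w| = 1.
Proof.
move=> w_prim; apply/eqP; rewrite -(@pexpr_eq1 _ _ n) ?(prim_order_gt0 w_prim) //.
by rewrite -normrX (prim_expr_order w_prim) normr1.
Qed.

(** A discrete mean value property: for [0 < k < n] we have [w^k != 1], so the geometric sum of the
    [(w^i)^k] vanishes and only the constant coefficient survives. *)
Lemma sum_prim_root_horner (F : fieldType) (n : nat) (w : F) (p : {poly F}) :
  n.-primitive_root w -> (size p <= n)%N ->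
  \sum_(i < n) p.[w ^+ i] = n%:R * p.[0].
Proof.
move=> w_prim sz_p.
under eq_bigr do rewrite (horner_coef_wide _ sz_p).
rewrite exchange_big /=.
case: n w_prim sz_p => [/prim_order_gt0//|n] w_prim sz_p.
rewrite big_ord_recl /= [X in _ + X]big1 => [|j _].
  under eq_bigr do rewrite expr0 mulr1.
  by rewrite sumr_const cardT size_enum_ord mulr_natl addr0 horner_coef0.
rewrite -mulr_sumr; have -> : bump 0 j = j.+1 by []; set k := j.+1.
suff -> : \sum_(i < n.+1) (w ^+ i) ^+ k = 0 by rewrite mulr0.
have wk_neq1 : w ^+ k - 1 != 0.
  rewrite subr_eq0 -(expr0 w) (eq_prim_root_expr w_prim) mod0n modn_small //.
  by rewrite ltnS ltn_ord.
apply: (mulfI wk_neq1); rewrite mulr0.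
under eq_bigr do rewrite -exprM mulnC exprM.
by rewrite -subrX1 -exprM mulnC exprM (prim_expr_order w_prim) expr1n subrr.
Qed.

(** A nonzero [p] has fewer than [size p] roots, while the circle contains [size p] distinct roots
    of unity. *)
Lemma poly_eq0_unit_circle (C : numClosedFieldType) (p : {poly C}) :
  (forall z, `|z| = 1 -> p.[z] = 0) -> p = 0.
Proof.
move=> p0; apply/eqP/negPn/negP => p_neq0.
have [|w w_prim] := @closed_prim_root_exists C (size p).
  by rewrite pnatr_eq0 size_poly_eq0.
have := @max_poly_roots _ _ [seq w ^+ i | i <- iota 0 (size p)] p_neq0.
rewrite size_map size_iota ltnn => /(_ _ _)/negP; apply => //.
  apply/allP => _ /mapP[i _ ->]; apply/rootP/p0.
  by rewrite normrX (norm_prim_root w_prim) expr1n.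
rewrite map_inj_in_uniq ?iota_uniq // => i j; rewrite !mem_iota !add0n /= => ip jp.
by move/eqP; rewrite (eq_prim_root_expr w_prim) !modn_small // => /eqP.
Qed.

(** * Reflection of polynomials in the unit circle *)

Definition reflect_poly (C : numClosedFieldType) (n : nat) (p : {poly C}) :=
  \poly_(i < n.+1) (p`_(n - i))^*.

(* The coefficient reversal is [z^n * conj (p (1 / conj z))], and
   [1 / conj z = z] on the unit circle. *)
Lemma horner_reflect_poly (C : numClosedFieldType) (n : nat) (p : {poly C}) z :
  (size p <= n.+1)%N -> `|z| = 1 ->
  (reflect_poly n p).[z] = z ^+ n * (p.[z])^*.
Proof.
move=> sz_p z1; have zz : z * z^* = 1 by rewrite -normCK z1 expr1n.
rewrite (horner_coef_wide _ sz_p) horner_poly rmorph_sum mulr_sumr /=.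
rewrite (reindex_inj rev_ord_inj) /=; apply: eq_bigr => i _.
have le_in : (i <= n)%N by rewrite -ltnS.
rewrite subSS (subKn le_in) rmorphM rmorphXn /= mulrCA; congr (_ * _).
have -> : z ^+ n = z ^+ (n - i) * z ^+ i by rewrite -exprD subnK.
by rewrite -mulrA -exprMn zz expr1n mulr1.
Qed.

(** * Numerators and denominators of Blaschke products *)

Definition blaschke_num (C : numClosedFieldType) (s : seq C) : {poly C} :=
  \prod_(a <- s) ('X - a%:P).

(** The reflection of [blaschke_num s], kept in factored form so that its value at 0 and its bounds
    on the circle can be read off factor by factor. *)
Definition blaschke_den (C : numClosedFieldType) (s : seq C) : {poly C} :=
  \prod_(a <- s) (1 - a^* *: 'X).

Lemma size_blaschke_num (C : numClosedFieldType) (s : seq C) :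
  size (blaschke_num s) = (size s).+1.
Proof. exact: size_prod_XsubC. Qed.

Lemma size_blaschke_den (C : numClosedFieldType) (s : seq C) :
  (size (blaschke_den s) <= (size s).+1)%N.
Proof.
rewrite /blaschke_den; elim: s => [|a s IHs]; first by rewrite big_nil size_poly1.
rewrite big_cons (leq_trans (size_polyMleq _ _)) //.
have : (size (1 - a^* *: 'X : {poly C})%R <= 2)%N.
  rewrite (leq_trans (size_polyD _ _)) // geq_max size_polyN size_poly1 /=.
  by rewrite (leq_trans (size_scale_leq _ _)) ?size_polyX.
by move=> /leq_add/(_ IHs); rewrite -ltnS; case: (_ + _)%N.
Qed.

Lemma horner_blaschke_num (C : numClosedFieldType) (s : seq C) z :
  (blaschke_num s).[z] = \prod_(a <- s) (z - a).
Proof. by rewrite horner_prod; apply: eq_bigr => a _; rewrite hornerXsubC. Qed.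

Lemma horner_blaschke_den (C : numClosedFieldType) (s : seq C) z :
  (blaschke_den s).[z] = \prod_(a <- s) (1 - a^* * z).
Proof. by rewrite horner_prod; apply: eq_bigr => a _; rewrite !hornerE. Qed.

Lemma blaschke_den0 (C : numClosedFieldType) (s : seq C) :
  (blaschke_den s).[0] = 1.
Proof. by rewrite horner_blaschke_den big1 // => a _; rewrite mulr0 subr0. Qed.

(** Since [z z^* = 1] on the circle, each factor satisfies [z - a = z conj (1 - a^* z)]. *)
Lemma blaschke_num_circle (C : numClosedFieldType) (s : seq C) z : `|z| = 1 ->
  (blaschke_num s).[z] = z ^+ size s * ((blaschke_den s).[z])^*.
Proof.
move=> z1; have zz : z * z^* = 1 by rewrite -normCK z1 expr1n.
rewrite horner_blaschke_num horner_blaschke_den rmorph_prod /=.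
elim: s => [|a s IHs]; first by rewrite !big_nil mulr1.
rewrite !big_cons IHs /= exprS mulrACA; congr (_ * _).
by rewrite rmorphB rmorph1 rmorphM /= conjCK mulrBr mulr1 mulrCA zz mulr1.
Qed.

Lemma blaschke_den_neq0 (C : numClosedFieldType) (s : seq C) z :
  (forall a, a \in s -> `|a| < 1) -> `|z| <= 1 -> (blaschke_den s).[z] != 0.
Proof.
move=> s1 z1; rewrite horner_blaschke_den prodf_seq_neq0; apply/allP => a /s1 a1.
rewrite implyTb subr_eq0; apply/negP => /eqP/(congr1 Num.norm)/eqP.
by rewrite normr1 normrM norm_conjC gt_eqF // (le_lt_trans _ a1) // ler_piMr.
Qed.

(** Factors are peeled off one at a time: at the head [x] the quotient loses one power of [X - x],
    and for any other [l] the power of [X - l] is coprime to [X - x], so it still divides the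
    quotient. *)
Lemma dvdp_blaschke_num (C : numClosedFieldType) (s : seq C) (p : {poly C}) :
  (forall l, l \in s -> ('X - l%:P) ^+ count_mem l s %| p) ->
  blaschke_num s %| p.
Proof.
rewrite /blaschke_num; elim: s p => [|x s IHs] p dvd_p.
  by rewrite big_nil dvd1p.
rewrite big_cons; have := dvd_p x (mem_head _ _).
rewrite /= eqxx exprS => /(dvdp_trans (dvdp_mulr _ (dvdpp _)))/dvdpP[q pE].
rewrite pE mulrC dvdp_mul2r ?polyXsubC_eq0 //; apply: IHs => l ls.
have := dvd_p l; rewrite in_cons ls orbT pE /= => /(_ isT).
have [->|lx] := eqVneq x l; first by rewrite exprS mulrC dvdp_mul2r ?polyXsubC_eq0.
rewrite add0n Gauss_dvdpl // coprimep_expl // coprimep_XsubC root_XsubC //.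
Qed.

(** The roots of the numerator lie in the disk, where the denominator has no zero. *)
Lemma coprime_blaschke (C : numClosedFieldType) (s : seq C) :
  (forall a, a \in s -> `|a| < 1) -> coprimep (blaschke_num s) (blaschke_den s).
Proof.
rewrite /blaschke_num => s1.
have : forall a, a \in s -> ~~ root (blaschke_den s) a.
  by move=> a /s1 a1; rewrite rootE blaschke_den_neq0 // ltW.
move: (blaschke_den s) => q; elim: {s1}s => [|a t IHt] ht.
  by rewrite big_nil coprime1p.
rewrite big_cons coprimepMl coprimep_sym coprimep_XsubC ht ?mem_head //=.
by apply: IHt => b bt; apply: ht; rewrite in_cons bt orbT.
Qed.

(** * Approximation of reciprocal denominators on the circle, and the vanishing of [c] *)

Lemma normr_exprn_lt (R : realType) (a e : Cplx R) : `|a| < 1 -> 0 < e ->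
  exists N : nat, `|a| ^+ N < e.
Proof.
move=> a1 e0.
(* Norms take values in [R[i]]; the limit of the powers is taken in [R], through real parts. *)
have /RRe_real aE : (`|a| : R[i]) \is Num.real by exact: normr_real.
have /RRe_real eE : (e : R[i]) \is Num.real by exact: gtr0_real.
set x := complex.Re _ in aE; set y := complex.Re _ in eE.
have x0 : 0 <= x by rewrite -lecR aE; exact: normr_ge0.
have x1 : x < 1 by rewrite -ltcR aE.
have y0 : 0 < y by rewrite -ltcR eE.
have /cvg_expr : `|x| < 1 by rewrite ger0_norm.
move=> /cvgr_dist_lt /(_ _ y0)[N _ /(_ N (leqnn N))].
rewrite /= sub0r normrN ger0_norm ?exprn_ge0 // => xy.
by exists N; rewrite -aE -eE -rmorphXn ltcR.
Qed.

Lemma norm_blaschke_den_le (C : numClosedFieldType) (s : seq C) (z : C) :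
  `|z| = 1 -> `|(blaschke_den s).[z]| <= \prod_(a <- s) (1 + `|a|).
Proof.
move=> z1; rewrite horner_blaschke_den normr_prod; apply: ler_prod => a _.
rewrite normr_ge0 (le_trans (ler_normB _ _)) //.
by rewrite normr1 normrM norm_conjC z1 mulr1.
Qed.

Lemma norm_blaschke_den_ge (C : numClosedFieldType) (s : seq C) (z : C) :
  (forall a, a \in s -> `|a| < 1) -> `|z| = 1 ->
  \prod_(a <- s) (1 - `|a|) <= `|(blaschke_den s).[z]|.
Proof.
move=> s1 z1; rewrite horner_blaschke_den normr_prod big_seq [leRHS]big_seq.
apply: ler_prod => a /s1 a1; rewrite subr_ge0 (ltW a1) /=.
by rewrite (le_trans _ (lerB_dist _ _)) // normr1 normrM norm_conjC z1 mulr1.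
Qed.

(** [T] is a product of truncated geometric series for [1 / (1 - a^* z)], which converge uniformly
    on the circle because [|a| < 1]. Each truncation has value 1 at 0. *)
Lemma approx_inv_blaschke_den (R : realType) (s : seq (Cplx R)) (e : Cplx R) :
  (forall a, a \in s -> `|a| < 1) -> 0 < e ->
  exists T : {poly Cplx R}, T.[0] = 1 /\
    forall z, `|z| = 1 -> `|T.[z] * (blaschke_den s).[z] - 1| <= e.
Proof.
elim: s e => [|a s IHs] e s1 e0.
  exists 1; split; first by rewrite hornerC.
  by move=> z _; rewrite hornerC horner_blaschke_den big_nil mulr1 subrr normr0 ltW.
have e20 : 0 < e / 2 by rewrite divr_gt0.
have [|//|T [T0 Te]] := IHs (e / 2).
  by move=> b bs; apply: s1; rewrite in_cons bs orbT.
have a1 : `|a| < 1 by apply/s1/mem_head.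
(* This bound on the geometric remainder absorbs the factor [|t| <= 1 + e / 2] below, leaving an
   error of [e / 2]. *)
have d0 : 0 < (e / 2) / (1 + e / 2) by rewrite divr_gt0 // addr_gt0.
have [N aN] := normr_exprn_lt a1 d0.
exists (T * \sum_(i < N.+1) (a^* *: 'X) ^+ i); split.
  rewrite hornerM T0 mul1r horner_sum big_ord_recl big1 ?addr0 ?expr0 ?hornerC //.
  by move=> i _; rewrite horner_exp hornerZ hornerX mulr0 expr0n.
move=> z z1; rewrite hornerM horner_blaschke_den big_cons -horner_blaschke_den.
rewrite [(1 - _) * _]mulrC mulrACA.
have -> : (\sum_(i < N.+1) (a^* *: 'X) ^+ i).[z] * (1 - a^* * z) =
    1 - (a^* * z) ^+ N.+1.
  rewrite horner_sum; under eq_bigr do rewrite horner_exp hornerZ hornerX.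
  by rewrite -[RHS]opprB subrX1 -[RHS]mulNr opprB mulrC.
set t := T.[z] * _; set y := (_ ^+ _).
have -> : t * (1 - y) - 1 = (t - 1) - t * y by ring.
have te : `|t - 1| <= e / 2 by exact: Te.
have t_le : `|t| <= 1 + e / 2.
  rewrite -[t](subrK 1) addrC (le_trans (ler_normD _ _)) // normr1 lerD2l //.
have y_le : `|y| <= (e / 2) / (1 + e / 2).
  rewrite normrX normrM norm_conjC z1 mulr1 exprS (le_trans _ (ltW aN)) //.
  by rewrite ler_piMl ?exprn_ge0 // ltW.
rewrite (le_trans (ler_normB _ _)) // [leRHS]splitr lerD // normrM.
rewrite (le_trans (ler_pM _ _ t_le y_le)) // mulrC divfK //.
by rewrite gt_eqF // addr_gt0.
Qed.

(* The means of [Qb / Qa] and of its conjugate are taken over roots of unity, after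
   replacing [1 / Qa] by a polynomial that is close to it on the circle. *)
Lemma blaschke_den_circle_eq0 (R : realType) (a b l : seq (Cplx R)) (c : Cplx R) :
  (forall x, x \in a -> `|x| < 1) -> (forall x, x \in l -> `|x| < 1) ->
  (forall z, `|z| = 1 ->
    ((blaschke_den a).[z])^* * (blaschke_den b).[z]
      - ((blaschke_den b).[z])^* * (blaschke_den a).[z]
    = c * `|(blaschke_den l).[z]| ^+ 2) ->
  c = 0.
Proof.
move=> a1 l1 Hc; apply/eqP/negPn/negP => c_neq0.
have c0 : 0 < `|c| by rewrite normr_gt0.
pose lo (s : seq (Cplx R)) : Cplx R := \prod_(x <- s) (1 - `|x|).
pose up (s : seq (Cplx R)) : Cplx R := \prod_(x <- s) (1 + `|x|).
have lo_gt0 s : (forall x : Cplx R, x \in s -> `|x| < 1) -> 0 < lo s.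
  by move=> s1; rewrite /lo big_seq prodr_gt0 // => x /s1; rewrite subr_gt0.
have up_gt0 s : 0 < up s by rewrite /up prodr_gt0 // => x _; rewrite ltr_pwDl.
(* On the circle [K] bounds [|Qb / Qa|] from above and [d] bounds [|Ql / Qa|^2] from below; [e] is
   chosen to make [2 K e] half of [|c| d]. *)
pose K := up b / lo a; pose d := (lo l / up a) ^+ 2.
have K0 : 0 < K by rewrite divr_gt0 // lo_gt0.
have d0 : 0 < d by rewrite exprn_gt0 // divr_gt0 // lo_gt0.
pose e := `|c| * d / (K * 4).
have e0 : 0 < e by apply: divr_gt0; apply: mulr_gt0.
have [T [T0 Te]] := approx_inv_blaschke_den a1 e0.
pose q := blaschke_den b * T.
have q0 : q.[0] = 1 by rewrite hornerM T0 blaschke_den0 mulr1.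
have q_neq0 : q != 0.
  by apply: contra_eq_neq q0 => ->; rewrite horner0 eq_sym oner_neq0.
(* [M] exceeds the degree of [q], so averaging [q] over the [M]-th roots of unity returns [q(0)]. *)
pose M := size q; have M_neq0 : (M%:R : Cplx R) != 0.
  by rewrite pnatr_eq0 size_poly_eq0.
have [w w_prim] := closed_prim_root_exists M_neq0.
pose h z := `|(blaschke_den l).[z] / (blaschke_den a).[z]| ^+ 2.
have w1 i : `|w ^+ i| = 1 by rewrite normrX (norm_prim_root w_prim) expr1n.
have h_ge z : `|z| = 1 -> d <= h z.
  move=> z1; rewrite /d /h; apply: lerXn2r; rewrite ?nnegrE ?normr_ge0 //.
    by rewrite ltW // divr_gt0 // lo_gt0.
  rewrite normrM normfV; apply: ler_pM.
  - by rewrite ltW // lo_gt0.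
  - by rewrite invr_ge0 ltW.
  - exact: norm_blaschke_den_ge.
  - rewrite lef_pV2 ?posrE //; first exact: norm_blaschke_den_le.
    by rewrite normr_gt0 blaschke_den_neq0 ?z1.
have step z : `|z| = 1 -> `|c * h z - (q.[z] - (q.[z])^*)| <= 2 * (K * e).
  move=> z1; have Qa0 : (blaschke_den a).[z] != 0.
    by rewrite blaschke_den_neq0 ?z1.
  (* Here [r = q - Qb / Qa], and dividing [Hc] by [|Qa|^2] gives
     [c h = Qb / Qa - conj (Qb / Qa)]. *)
  pose r := (blaschke_den b).[z] / (blaschke_den a).[z]
            * (T.[z] * (blaschke_den a).[z] - 1).
  have r_le : `|r| <= K * e.
    rewrite normrM; apply: ler_pM => //; last exact: Te.
    rewrite normrM normfV; apply: ler_pM => //; first exact: norm_blaschke_den_le.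
    rewrite lef_pV2 ?posrE ?normr_gt0 ?lo_gt0 //.
    exact: norm_blaschke_den_ge.
  have -> : c * h z - (q.[z] - (q.[z])^*) = r^* - r.
    rewrite /h normrM exprMn mulrA -Hc // normfV exprVn normCK /r hornerM.
    rewrite !(rmorphM, rmorphB, rmorph1, fmorphV) /=.
    by field; rewrite Qa0 conjC_eq0 Qa0.
  by rewrite (le_trans (ler_normB _ _)) // norm_conjC mulrDl mul1r lerD.
(* The mean of [q] is [q(0) = 1], which is real. *)
have q_mean : \sum_(i < M) (q.[w ^+ i] - (q.[w ^+ i])^*) = 0.
  rewrite sumrB -rmorph_sum /= (sum_prim_root_horner w_prim (leqnn _)) q0.
  by rewrite mulr1 conjC_nat subrr.
(* Averaging [step] and using [h >= d] contradicts the choice of [e]. *)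
have : `|c| * d * M%:R <= 2 * (K * e) * M%:R.
  have -> : 2 * (K * e) * M%:R = \sum_(i < M) (2 * (K * e)).
    by rewrite sumr_const cardT size_enum_ord mulr_natr.
  have le_sum : `|\sum_(i < M) (c * h (w ^+ i) - (q.[w ^+ i] - (q.[w ^+ i])^*))|
      <= \sum_(i < M) (2 * (K * e)).
    by rewrite (le_trans (ler_norm_sum _ _ _)) // ler_sum // => i _; apply: step.
  apply: le_trans le_sum.
  rewrite sumrB q_mean subr0 -mulr_sumr normrM -mulrA ler_wpM2l // ger0_norm.
    have -> : d * M%:R = \sum_(i < M) d.
      by rewrite sumr_const cardT size_enum_ord mulr_natr.
    by rewrite ler_sum // => i _; apply: h_ge.
  by rewrite sumr_ge0 // => i _; rewrite exprn_ge0.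
rewrite ler_pM2r; last by rewrite lt0r M_neq0 ler0n.
suff -> : 2 * (K * e) = `|c| * d / 2.
  have cd_half : `|c| * d / 2 < `|c| * d.
    by rewrite ltr_pdivrMr // mulr_natr mulr2n ltrDl mulr_gt0.
  by move=> /le_lt_trans/(_ cd_half); rewrite ltxx.
by rewrite /e; field; rewrite gt_eqF.
Qed.

(** * From local vanishing order to divisibility *)

Lemma horner_continuous (K : numFieldType) (p : {poly K}) (x : K) :
  {for x, continuous (horner p)}.
Proof.
elim/poly_ind: p => [|p c IHp].
  have -> : horner 0 = (fun=> 0) :> (K -> K).
    by apply/funext => y; rewrite horner0.
  exact: cst_continuous.
have -> : horner (p * 'X + c%:P) = (fun y => p.[y] * y + c).
  by apply/funext => y; rewrite !hornerE.
apply: (@continuousD _ _ _ (fun y => p.[y] * y) (fun=> c)); last exact: cst_continuous.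
apply: (@continuousM _ _ (horner p) id) => //.
Qed.

(** Let [m] be the exact multiplicity of [l] in [p], with cofactor [q]. If [m < k], cancelling
    [(z - l)^m] off [l] and letting [z] tend to [l] gives [q(l) = 0], a contradiction. *)
Lemma dvdp_XsubC_exp_near (K : numFieldType) (p : {poly K}) (g : K -> K) k l :
  {for l, continuous g} -> (\forall z \near l, p.[z] = (z - l) ^+ k * g z) ->
  ('X - l%:P) ^+ k %| p.
Proof.
move=> g_cont p_near; have [->|p0] := eqVneq p 0; first exact: dvdp0.
have [m [q]] := multiplicity_XsubC p l; rewrite p0 /= => q_l pE; rewrite pE.
have [km|mk] := leqP k m; first by rewrite dvdp_mull // dvdp_exp2l.
case/negP: q_l; apply/rootP.
pose r : {poly K} := ('X - l%:P) ^+ (k - m).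
have q_near : \forall z \near l^', r.[z] * g z = q.[z].
  near=> z; have zl : z - l != 0 by rewrite subr_eq0; near: z; exact: nbhs_dnbhs_neq.
  apply: (mulIf (expf_neq0 m zl)).
  rewrite horner_exp hornerXsubC mulrAC -exprD subnK; last exact: ltnW.
  have : p.[z] = (z - l) ^+ k * g z by near: z; exact: cvg_within.
  by rewrite pE hornerM horner_exp hornerXsubC => ->.
have q_cvg : q.[z] @[z --> l^'] --> q.[l].
  exact/continuous_withinNx/horner_continuous.
have r_cvg : r.[z] * g z @[z --> l^'] --> r.[l] * g l.
  apply/(continuous_withinNx (fun z => r.[z] * g z)).
  by apply: (@continuousM _ _ (horner r) g) => //; exact: horner_continuous.
rewrite horner_exp hornerXsubC subrr expr0n subn_eq0 leqNgt mk mul0r in r_cvg.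
apply: (cvg_unique _ q_cvg); first exact: norm_hausdorff.
by apply: cvg_trans r_cvg; exact: near_eq_cvg.
Unshelve. all: by end_near.
Qed.

(** * The numerator of [A - B]: its factorization and its vanishing *)

Lemma unit_disk_near (R : realType) (l : Cplx R) :
  unit_disk l -> \forall z \near l, unit_disk z.
Proof. exact: (cvgr_norm_lt (F := nbhs l) (f := id) l cvg_id). Qed.

(* [F = Pa Qb - Pb Qa] satisfies [z^(2n) conj (F (1 / conj z)) = - F z], so its
   zeros [l] force the zeros [1 / conj l]. *)
Lemma blaschke_diff_factor (C : numClosedFieldType) (a b l : seq C) :
  size a = size l -> size b = size l -> (forall x, x \in l -> `|x| < 1) ->
  blaschke_num l %|
    blaschke_num a * blaschke_den b - blaschke_num b * blaschke_den a ->
  exists c : C,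
    blaschke_num a * blaschke_den b - blaschke_num b * blaschke_den a
    = c *: (blaschke_num l * blaschke_den l).
Proof.
set F := blaschke_num a * blaschke_den b - blaschke_num b * blaschke_den a.
set n := size l => an bn l1 /dvdpP[G FE].
have [F0|F_neq0] := eqVneq F 0; first by exists 0; rewrite F0 scale0r.
have G0 : G != 0 by apply: contraNneq F_neq0 => G0; rewrite FE G0 mul0r.
have szF : (size F <= (n + n).+1)%N.
  have szM (s t : seq C) : size s = n -> size t = n ->
      (size (blaschke_num s * blaschke_den t)%R <= (n + n).+1)%N.
    move=> sn tn; rewrite (leq_trans (size_polyMleq _ _)) // size_blaschke_num.
    by rewrite sn addSn /= -addnS leq_add2l -tn size_blaschke_den.
  by rewrite (leq_trans (size_polyD _ _)) // geq_max size_polyN !szM.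
have szG : (size G <= n.+1)%N.
  move: szF; rewrite FE size_mul // ?[blaschke_num l != 0]monic_neq0
    ?monic_prod_XsubC //.
  by rewrite size_blaschke_num addnS /= -addSn leq_add2r.
have FG : F = - (blaschke_den l * reflect_poly n G).
  apply/eqP; rewrite -subr_eq0 opprK; apply/eqP.
  apply: poly_eq0_unit_circle => z z1.
  have zz : z * z^* = 1 by rewrite -normCK z1 expr1n.
  rewrite hornerD hornerM horner_reflect_poly //.
  (* The second summand is rewritten as the reflection [z^(2n) conj (F z)]; the antisymmetry of [F]
     then finishes. *)
  have <- : (F.[z])^* * z ^+ n * z ^+ n = (blaschke_den l).[z] * (z ^+ n * G.[z]^*).
    rewrite FE hornerM rmorphM /= blaschke_num_circle // rmorphM rmorphXn /= conjCK -/n.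
    have zn : z ^+ n * z^* ^+ n = 1 by rewrite -exprMn zz expr1n.
    transitivity
      (z ^+ n * z^* ^+ n * ((blaschke_den l).[z] * (z ^+ n * G.[z]^*))); first by ring.
    by rewrite zn mul1r.
  rewrite /F hornerD hornerN !hornerM !blaschke_num_circle // an bn.
  rewrite rmorphB !rmorphM !rmorphXn /= !conjCK.
  have zn : z ^+ n * z^* ^+ n = 1 by rewrite -exprMn zz expr1n.
  ring: zn.
(* [blaschke_num l] divides [F] and is coprime to [blaschke_den l], so it divides the other factor;
   comparing degrees, the quotient [H] is constant. *)
have : blaschke_num l %| reflect_poly n G.
  rewrite -(Gauss_dvdpr _ (coprime_blaschke l1)) -dvdpNr -FG FE.
  exact: dvdp_mull.
case/dvdpP => H HE.
have szH : (size H <= 1)%N.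
  have [->|H0] := eqVneq H 0; first by rewrite size_poly0.
  have : (size (reflect_poly n G) <= n.+1)%N by exact: size_poly.
  rewrite HE size_mul // ?[blaschke_num l != 0]monic_neq0 ?monic_prod_XsubC //.
  by rewrite size_blaschke_num addnS /= -(add1n n) leq_add2r.
have HC := size1_polyC szH; exists (- H`_0).
by rewrite FG HE HC mulrCA mul_polyC coefC /= scaleNr [_ * blaschke_num l]mulrC.
Qed.

Theorem theorem2p3 (R : realType) (n : nat) (A B : Cplx R -> Cplx R)
    (hA : monic_blaschke n A) (hB : monic_blaschke n B)
    (lam : n.-tuple (Cplx R))
    (hlam : forall l, l \in lam -> unit_disk l)
    (hAB : agree_counting_multiplicities A B lam) :
  forall z : Cplx R, unit_disk z -> A z = B z.
Proof.
have [a [a1 Aa]] := hA; have [b [b1 Bb]] := hB.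
have blaschkeE s (z : Cplx R) :
    blaschke s z = (blaschke_num s).[z] / (blaschke_den s).[z].
  rewrite horner_blaschke_num horner_blaschke_den -prodfV -big_split.
  by [].
set F := blaschke_num a * blaschke_den b - blaschke_num b * blaschke_den a.
have Qa0 z : unit_disk z -> (blaschke_den a).[z] != 0.
  by move=> /ltW z1; rewrite blaschke_den_neq0.
have Qb0 z : unit_disk z -> (blaschke_den b).[z] != 0.
  by move=> /ltW z1; rewrite blaschke_den_neq0.
have FE z : unit_disk z ->
    F.[z] = (blaschke_den a).[z] * (blaschke_den b).[z] * (A z - B z).
  move=> z1; rewrite Aa // Bb // !blaschkeE /F hornerD hornerN !hornerM.
  by field; rewrite Qa0 // Qb0.
have dvdF : blaschke_num lam %| F.
  apply: dvdp_blaschke_num => l ll; have [g [g_der g_eq]] := hAB l ll.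
  (* Near [l] we have [F = Qa Qb (A - B)], so [Qa Qb g] is a cofactor for [F]. *)
  apply: (@dvdp_XsubC_exp_near _ _
    (fun z => (blaschke_den a * blaschke_den b).[z] * g z)).
    apply: (@continuousM (Cplx R) (Cplx R) (horner _) g l); first exact: horner_continuous.
    by apply/differentiable_continuous/derivable1_diffP; exact: nbhs_singleton g_der.
  have := unit_disk_near (hlam l ll); apply: filterS2 g_eq => z zE z1.
  by rewrite FE // zE hornerM mulrCA.
have [||c Fc] := blaschke_diff_factor _ _ hlam dvdF; rewrite ?size_tuple //.
have c0 : c = 0.
  apply: (@blaschke_den_circle_eq0 _ a b lam c) => // z z1.
  have zz : z * z^* = 1 by rewrite -normCK z1 expr1n.
  have zn : z ^+ n * z^* ^+ n = 1 by rewrite -exprMn zz expr1n.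
  have z0 : z ^+ n != 0 by rewrite expf_neq0 // -normr_gt0 z1.
  (* On the circle both sides of [Fc] carry a factor [z^n], and [Pl Ql = z^n |Ql|^2]. *)
  apply: (mulfI z0); have := congr1 (horner^~ z) Fc.
  rewrite hornerZ hornerD hornerN !hornerM !blaschke_num_circle //.
  rewrite !size_tuple normCK.
  by move=> h; transitivity
    (z ^+ n * (blaschke_den a).[z]^* * (blaschke_den b).[z]
     - z ^+ n * (blaschke_den b).[z]^* * (blaschke_den a).[z]);
    [ring | rewrite h; ring].
(* Now [F = 0], while [Qa] and [Qb] have no zero in the disk. *)
move=> z z1; have := FE z z1; rewrite /F Fc c0 scale0r horner0 => /esym/eqP.
by rewrite !mulf_eq0 (negbTE (Qa0 _ z1)) (negbTE (Qb0 _ z1)) /= subr_eq0 => /eqP.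
Qed.
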